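(* Let $F_2$ be the free group on two generators, with identity $e_{F_2}$. For each $n\in\mathbb{N}$, let $K_n=\bigcap\{\ker(\phi):\phi\colon F_2\to\Gamma\text{ is a group homomorphism},\ |\Gamma|\le n\}$, and let $\mathcal{G}$ be the HLS groupoid associated to $(F_2,(K_n)_{n\in\mathbb{N}})$. Consider the unit $u=(\infty,e_{F_2})\in\mathcal{G}^{(0)}$. Let $J_u^r$ be the closure in $C_r^*(\mathcal{I}^{\mathcal{G}})$ of $\{f\in C_c(\mathcal{I}^{\mathcal{G}}): f|_{\mathcal{I}^{\mathcal{G}}_u}\equiv 0\}$, and let $\theta_u^r\colon C_r^*(\mathcal{I}^{\mathcal{G}})/J_u^r\to C_r^*(\mathcal{I}^{\mathcal{G}}_u)$ be the surjective $*$-homomorphism satisfying $\theta_u^r(f+J_u^r)=f|_{\mathcal{I}^{\mathcal{G}}_u}$ for all $f\in C_c(\mathcal{I}^{\mathcal{G}})$. Then $\theta_u^r$ is not injective.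
   Context: An approximating sequence for a discrete group $\Gamma$ is a nested decreasing sequence $(K_n)_{n\in\mathbb{N}}$ of finite-index normal subgroups of $\Gamma$ with $\bigcap_n K_n=\{e\}$; the sequence $(K_n)$ in the claim is an approximating sequence for $F_2$. Put $\Gamma_n=\Gamma/K_n$ for $n\in\mathbb{N}$ and $\Gamma_\infty=\Gamma$, with quotient maps $\pi_n\colon\Gamma\to\Gamma_n$ ($\pi_\infty=\mathrm{id}$). The associated HLS groupoid is $\mathcal{G}=\bigsqcup_{n\in\mathbb{N}\cup\{\infty\}}\{n\}\times\Gamma_n$, with groupoid operations given by the group structure on each fibre, so the units are $(n,e_{\Gamma_n})$ and $r(n,g)=s(n,g)=(n,e_{\Gamma_n})$. Its topology is generated by the singletons $\{(n,g)\}$ with $n\in\mathbb{N}$, $g\in\Gamma_n$, together with the sets $\{(n,\pi_n(g)): n\in\mathbb{N}\cup\{\infty\},\ n>N\}$ for $g\in\Gamma$, $N\in\mathbb{N}$. It is a second-countable locally compact Hausdorff étale groupoid. $\mathrm{Iso}(\mathcal{G})=\{\gamma:r(\gamma)=s(\gamma)\}$, $\mathcal{I}^{\mathcal{G}}$ is its topological interior in $\mathcal{G}$ (here $\mathcal{I}^{\mathcal{G}}=\mathcal{G}$), and $\mathcal{I}^{\mathcal{G}}_u=\{\gamma\in\mathcal{I}^{\mathcal{G}}:r(\gamma)=s(\gamma)=u\}$, a discrete group. For an étale groupoid $\mathcal{H}$, $C_c(\mathcal{H})$ is the usual convolution $*$-algebra, with $(fg)(\gamma)=\sum_{\alpha\beta=\gamma}f(\alpha)g(\beta)$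 and $f^*(\gamma)=\overline{f(\gamma^{-1})}$, and $C_r^*(\mathcal{H})$ is its (untwisted) reduced C*-algebra, i.e. the completion in the norm $\|f\|_r=\sup_{v\in\mathcal{H}^{(0)}}\|\pi_v(f)\|$, where $\pi_v$ is the representation by convolution on $\ell^2(s^{-1}(v))$. *)

(* Defs.v *)
From HB Require Import structures.
From mathcomp Require Import all_boot all_order all_algebra all_fingroup.
From mathcomp Require Import generic_quotient complex.
From mathcomp Require Import all_classical all_reals all_analysis.
Set Implicit Arguments.
Unset Strict Implicit.
Unset Printing Implicit Defensive.
Import Order.TTheory GRing.Theory Num.Theory.
Import numFieldNormedType.Exports.
Local Open Scope classical_set_scope.
Local Open Scope ring_scope.
Local Open Scope quotient_scope.

(* The free group on two generators: reduced words in the letters (i, e), where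
   i : bool selects the generator and e = true marks its inverse. *)
Definition letter : Type := (bool * bool)%type.
HB.instance Definition _ := Finite.on letter.
Definition linv (x : letter) : letter := (x.1, ~~ x.2).

Definition reduced (w : seq letter) := sorted (fun x y => y != linv x) w.

Definition push (x : letter) (w : seq letter) :=
  if w is y :: w' then if y == linv x then w' else x :: w else [:: x].

Definition wmul (u v : seq letter) := foldr push v u.
Definition winv (w : seq letter) := rev [seq linv x | x <- w].

Lemma linvK : involutive linv.
Proof. by case=> i e; rewrite /linv /= negbK. Qed.

Lemma reduced_tl x w : reduced (x :: w) -> reduced w.
Proof. exact: path_sorted. Qed.

Lemma reduced_push x w : reduced w -> reduced (push x w).
Proof.
case: w => [|y w] //= rw; case: ifP => [_|/negbT nyx]; first exact: path_sorted rw.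
by rewrite /= nyx.
Qed.

Lemma reduced_wmul u v : reduced v -> reduced (wmul u v).
Proof. by move=> rv; elim: u => //= x u IHu; apply: reduced_push. Qed.

Lemma pushK x w : reduced w -> push x (push (linv x) w) = w.
Proof.
case: w => [|y w] /= rw; first by rewrite eqxx.
rewrite linvK; case: eqP => [yx|_] /=; last by rewrite eqxx.
by rewrite yx in rw *; case: w rw => [|z w] //= /andP[/negPf ->].
Qed.

Lemma wmul_push x t w : reduced w -> wmul (push x t) w = push x (wmul t w).
Proof.
case: t => [|y t] //= rw; case: eqP => [->|//] /=.
by rewrite pushK //; exact: reduced_wmul.
Qed.

Lemma wmulA u v w : reduced w -> wmul u (wmul v w) = wmul (wmul u v) w.
Proof. by move=> rw; elim: u => //= x u ->; rewrite wmul_push. Qed.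

Lemma wmulw0 u : reduced u -> wmul u [::] = u.
Proof.
elim: u => //= x u IHu ru; rewrite IHu; last exact: path_sorted ru.
by case: u ru {IHu} => [|y u] //= /andP[/negPf ->].
Qed.

Lemma reduced_winv w : reduced w -> reduced (winv w).
Proof.
rewrite /reduced /winv rev_sorted sorted_map; apply: sub_sorted => x y /=.
by apply: contra => /eqP; rewrite linvK => ->.
Qed.

Lemma winvK : involutive winv.
Proof. by move=> w; rewrite /winv map_rev revK mapK //; exact: linvK. Qed.

Lemma wmulVw w : wmul (winv w) w = [::].
Proof.
elim: w => //= x w IHw; rewrite /winv /= rev_cons /wmul foldr_rcons /=.
by rewrite linvK eqxx.
Qed.

Record F2 := MkF2 { f2word :> seq letter; _ : reduced f2word }.
HB.instance Definition _ := [isSub for f2word].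
HB.instance Definition _ := [Choice of F2 by <:].

Lemma f2wordP (g : F2) : reduced g. Proof. by case: g. Qed.

Definition f2one : F2 := @MkF2 [::] isT.
Definition f2mul (g h : F2) : F2 := MkF2 (reduced_wmul g (f2wordP h)).
Definition f2inv (g : F2) : F2 := MkF2 (reduced_winv (f2wordP g)).

Lemma f2mulA : associative f2mul.
Proof. by move=> g h k; apply: val_inj; exact: wmulA (f2wordP k). Qed.
Lemma f2mul1g : left_id f2one f2mul.
Proof. by move=> g; exact: val_inj. Qed.
Lemma f2mulg1 : right_id f2one f2mul.
Proof. by move=> g; apply: val_inj; exact: wmulw0 (f2wordP g). Qed.
Lemma f2mulVg : left_inverse f2one f2inv f2mul.
Proof. by move=> g; apply: val_inj; exact: wmulVw. Qed.
Lemma f2mulgV : right_inverse f2one f2inv f2mul.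
Proof. by move=> g; apply: val_inj; rewrite /= -{1}[f2word g]winvK; exact: wmulVw. Qed.

HB.instance Definition _ :=
  isGroup.Build F2 f2mulA f2mul1g f2mulg1 f2mulVg f2mulgV.

Definition f2gen (i : bool) : F2 := @MkF2 [:: (i, false)] isT.

Lemma f2_push (x : letter) (w : seq letter) (rxw : reduced (x :: w)) :
  MkF2 rxw = ((if x.2 then (f2gen x.1)^-1 else f2gen x.1)
              * MkF2 (reduced_tl rxw))%g.
Proof.
apply: val_inj; case: x rxw => i [] /=; case: w => [|y w] //= /andP[/negPf h _];
  by rewrite h.
Qed.

Lemma F2_universal (H : groupType) (a : bool -> H) :
  exists! phi : F2 -> H,
    {morph phi : x y / (x * y)%g} /\ forall i, phi (f2gen i) = a i.
Proof.
pose l (x : letter) : H := if x.2 then ((a x.1)^-1)%g else a x.1.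
pose ev (w : seq letter) : H := foldr (fun x h => l x * h)%g 1%g w.
have lV x : (l x * l (linv x) = 1)%g.
  by case: x => i [] /=; rewrite /l /= ?mulgV ?mulVg.
have ev_push x w : ev (push x w) = (l x * ev w)%g.
  case: w => [|y w] //=; case: eqP => [->|//].
  by rewrite mulgA lV mul1g.
have evM u v : ev (wmul u v) = (ev u * ev v)%g.
  elim: u => [|x u IHu] /=; first by rewrite mul1g.
  by rewrite ev_push IHu mulgA.
exists (fun g => ev g); split.
  by split=> [g h|i]; [exact: evM | rewrite /ev /= /l /= mulg1].
move=> psi [psiM psiG].
have psi1 : psi 1%g = 1%g.
  by apply: (mulgI (psi 1%g)); rewrite -psiM !mulg1.
have psiV g : psi g^-1%g = ((psi g)^-1)%g.
  by apply: (mulgI (psi g)); rewrite -psiM !mulgV.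
apply/funext => -[w rw]; elim: w rw => [|x w IHw] rw.
  by rewrite /= -psi1; congr psi; exact: val_inj.
rewrite [in RHS]f2_push psiM -IHw /= -/(ev w); congr (_ * _)%g.
by rewrite /l; case: x.2; rewrite ?psiV psiG.
Qed.

Record normal_subgroup (G : groupType) := NormalSubgroup {
  nsset : set G;
  ns1 : nsset 1%g;
  nsM : forall x y, nsset x -> nsset y -> nsset (x * y)%g;
  nsV : forall x, nsset x -> nsset x^-1%g;
  nsJ : forall x y, nsset x -> nsset (x ^ y)%g }.

Section Quotient.
Variables (G : groupType) (K : normal_subgroup G).

Definition coset_rel (x y : G) : bool := `[< nsset K (x^-1 * y)%g >].

Lemma coset_rel_refl : reflexive coset_rel.
Proof. by move=> x; apply/asboolP; rewrite mulVg; exact: ns1. Qed.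
Lemma coset_rel_sym : symmetric coset_rel.
Proof.
by move=> x y; apply/asboolP/asboolP => /nsV; rewrite invgM invgK.
Qed.
Lemma coset_rel_trans : transitive coset_rel.
Proof.
move=> y x z /asboolP Kxy /asboolP Kyz; apply/asboolP.
by have := nsM Kxy Kyz; rewrite -mulgA mulKVg.
Qed.

Canonical coset_equiv :=
  EquivRel coset_rel coset_rel_refl coset_rel_sym coset_rel_trans.
Definition quotg := {eq_quot coset_equiv}.
HB.instance Definition _ := Choice.on quotg.

Definition quotg_pi (x : G) : quotg := \pi_quotg x.
Definition quotg_one : quotg := quotg_pi 1%g.
Definition quotg_inv (a : quotg) : quotg := quotg_pi (repr a)^-1%g.
Definition quotg_mul (a b : quotg) : quotg := quotg_pi (repr a * repr b)%g.

Lemma quotg_piP x y : quotg_pi x = quotg_pi y <-> nsset K (x^-1 * y)%g.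
Proof.
split=> [/eqquotP/asboolP //|Kxy].
by apply/eqquotP; exact/asboolP.
Qed.

Lemma quotg_repr a : quotg_pi (repr a) = a.
Proof. exact: reprK. Qed.

Lemma quotg_surj a : exists x, a = quotg_pi x.
Proof. by exists (repr a); rewrite quotg_repr. Qed.

Lemma quotg_pi_inv x : quotg_inv (quotg_pi x) = quotg_pi x^-1%g.
Proof.
have /quotg_piP Krx := quotg_repr (quotg_pi x).
apply/quotg_piP; rewrite invgK.
have := nsV (nsJ (repr (quotg_pi x))^-1%g Krx).
by rewrite conjgE invgK !mulgA mulgV mul1g invgM invgK.
Qed.

Lemma quotg_pi_mul x y :
  quotg_mul (quotg_pi x) (quotg_pi y) = quotg_pi (x * y)%g.
Proof.
have /quotg_piP Krx := quotg_repr (quotg_pi x).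
have /quotg_piP Kry := quotg_repr (quotg_pi y).
apply/quotg_piP; have := nsM (nsJ (repr (quotg_pi y)) Krx) Kry.
by rewrite conjgE invgM !mulgA mulgK.
Qed.

Lemma quotg_mulA : associative quotg_mul.
Proof.
move=> a b c; case: (quotg_surj a) (quotg_surj b) (quotg_surj c).
by move=> x -> [y ->] [z ->]; rewrite !quotg_pi_mul mulgA.
Qed.
Lemma quotg_mul1g : left_id quotg_one quotg_mul.
Proof. by move=> a; case: (quotg_surj a) => x ->; rewrite quotg_pi_mul mul1g. Qed.
Lemma quotg_mulg1 : right_id quotg_one quotg_mul.
Proof. by move=> a; case: (quotg_surj a) => x ->; rewrite quotg_pi_mul mulg1. Qed.
Lemma quotg_mulVg : left_inverse quotg_one quotg_inv quotg_mul.
Proof.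
move=> a; case: (quotg_surj a) => x ->.
by rewrite quotg_pi_inv quotg_pi_mul mulVg.
Qed.
Lemma quotg_mulgV : right_inverse quotg_one quotg_inv quotg_mul.
Proof.
move=> a; case: (quotg_surj a) => x ->.
by rewrite quotg_pi_inv quotg_pi_mul mulgV.
Qed.

HB.instance Definition _ := isGroup.Build quotg
  quotg_mulA quotg_mul1g quotg_mulg1 quotg_mulVg quotg_mulgV.
End Quotient.

(* The units are the arrows x with gsrc x = x.  gmul is a total function whose
   value is only meaningful on composable pairs, gsrc x = grng y. *)
Record groupoid := Groupoid {
  arrow :> topologicalType;
  gsrc : arrow -> arrow;
  grng : arrow -> arrow;
  gmul : arrow -> arrow -> arrow;
  ginv : arrow -> arrow;
  gsrc_src : forall x, gsrc (gsrc x) = gsrc x;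
  grng_src : forall x, grng (gsrc x) = gsrc x;
  gsrc_rng : forall x, gsrc (grng x) = grng x;
  grng_rng : forall x, grng (grng x) = grng x;
  gsrc_mul : forall x y, gsrc x = grng y -> gsrc (gmul x y) = gsrc y;
  grng_mul : forall x y, gsrc x = grng y -> grng (gmul x y) = grng x;
  gmulA : forall x y z, gsrc x = grng y -> gsrc y = grng z ->
    gmul x (gmul y z) = gmul (gmul x y) z;
  gmul_rng : forall x, gmul (grng x) x = x;
  gmul_src : forall x, gmul x (gsrc x) = x;
  gsrc_inv : forall x, gsrc (ginv x) = grng x;
  grng_inv : forall x, grng (ginv x) = gsrc x;
  gmulV : forall x, gmul x (ginv x) = grng x;
  gmulVx : forall x, gmul (ginv x) x = gsrc x }.

Section HLS.
Variables (G : groupType) (K : nat -> normal_subgroup G).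

(* The index None is infinity. *)
Definition hls_fiber (n : option nat) : groupType :=
  if n is Some k then quotg (K k) else G.

Definition hls_pi (n : option nat) : G -> hls_fiber n :=
  if n is Some k then @quotg_pi G (K k) else id.

Definition idx_gt (N : nat) (n : option nat) : bool :=
  if n is Some k then (N < k)%N else true.

Definition hls : Type := {n : option nat & hls_fiber n}.
Definition hlsE (n : option nat) (g : hls_fiber n) : hls := Tagged hls_fiber g.

Definition hls_generators : set (set hls) :=
  [set U | (exists (n : nat) (g : hls_fiber (Some n)), U = [set hlsE g]) \/
           (exists (g : G) (N : nat),
              U = [set hlsE (hls_pi n g) | n in [set n | idx_gt N n]])].

HB.instance Definition _ := Choice.on hls.
HB.instance Definition _ :=
  @isSubBaseTopological.Build hls (set hls) hls_generators id.

Definition hls_unit (x : hls) : hls := hlsE (1%g : hls_fiber (tag x)).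
Definition hls_mul (x y : hls) : hls := hlsE (tagged x * tagged_as x y)%g.
Definition hls_inv (x : hls) : hls := hlsE (tagged x)^-1%g.

Lemma hls_unit_tag (x y : hls) : hls_unit x = hls_unit y -> tag x = tag y.
Proof. by move=> /(congr1 tag). Qed.

Lemma hls_mulE n (g h : hls_fiber n) :
  hls_mul (hlsE g) (hlsE h) = hlsE (g * h)%g.
Proof. by rewrite /hls_mul tagged_asE. Qed.

Lemma hls_mulA (x y z : hls) : hls_unit x = hls_unit y ->
  hls_unit y = hls_unit z -> hls_mul x (hls_mul y z) = hls_mul (hls_mul x y) z.
Proof.
case: x y z => n g [m h] [k l] /hls_unit_tag /= nm /hls_unit_tag /= mk.
subst m k.
by rewrite (hls_mulE h l) (hls_mulE g (h * l)%g) (hls_mulE g h)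
  (hls_mulE (g * h)%g l) mulgA.
Qed.

Lemma hls_mul1x (x : hls) : hls_mul (hls_unit x) x = x.
Proof. by case: x => n g; rewrite (hls_mulE 1%g g) mul1g. Qed.
Lemma hls_mulx1 (x : hls) : hls_mul x (hls_unit x) = x.
Proof. by case: x => n g; rewrite (hls_mulE g 1%g) mulg1. Qed.
Lemma hls_mulxV (x : hls) : hls_mul x (hls_inv x) = hls_unit x.
Proof. by case: x => n g; rewrite (hls_mulE g g^-1%g) mulgV. Qed.
Lemma hls_mulVx (x : hls) : hls_mul (hls_inv x) x = hls_unit x.
Proof. by case: x => n g; rewrite (hls_mulE g^-1%g g) mulVg. Qed.

Definition HLS : groupoid := @Groupoid hls hls_unit hls_unit hls_mul hls_inv
  (fun=> erefl) (fun=> erefl) (fun=> erefl) (fun=> erefl)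
  (fun _ _ e => e) (fun _ _ _ => erefl) hls_mulA hls_mul1x hls_mulx1
  (fun=> erefl) (fun=> erefl) hls_mulxV hls_mulVx.

Definition hls_unit_infty : HLS := hlsE (1%g : hls_fiber None).
End HLS.

Definition iso (H : groupoid) : set H := [set x | grng x = gsrc x].
Arguments iso : clear implicits.
Definition iso_interior (H : groupoid) : set H := (iso H)°.
Arguments iso_interior : clear implicits.
Definition iso_interior_at (H : groupoid) (u : H) : set H :=
  [set x | iso_interior H x /\ grng x = u /\ gsrc x = u].

(* Functions on a subgroupoid S of H (with the subspace topology) are represented
   by their extension by 0 to H; convolution over S is then convolution over H. *)
Section ReducedNorm.
Variables (R : realType) (H : groupoid).
Implicit Types (S : set H) (f g xi : H -> R[i]).

Definition Cc S : set (H -> R[i]) :=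
  [set f | (forall x, ~ S x -> f x = 0) /\
           {within S, continuous (f : H -> R[i]^o)} /\
           exists C : set H, [/\ compact C, C `<=` S &
                                 forall x, f x != 0 -> C x]].

Definition conv f g : H -> R[i] := fun x =>
  \sum_(p \in [set p : H * H | gsrc p.1 = grng p.2 /\ gmul p.1 p.2 = x])
    (f p.1 * g p.2).

Definition fstar f : H -> R[i] := fun x => (f (ginv x))^*.

Definition frestrict S f : H -> R[i] := fun x => if x \in S then f x else 0.

Definition l2norm xi : \bar R :=
  sqrte (\esum_(x in [set: H]) ((complex.Re `|xi x|) ^+ 2)%:E)%E.

Definition ell2_ball S (v : H) : set (H -> R[i]) :=
  [set xi | (forall x, ~ (S x /\ gsrc x = v) -> xi x = 0) /\
            (l2norm xi <= 1)%E].

(* The operator norm of pi_v f on ell^2 of the arrows of S with source v. *)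
Definition pi_norm S f (v : H) : \bar R :=
  ereal_sup [set l2norm (conv f xi) | xi in ell2_ball S v].

Definition rnorm S f : \bar R :=
  ereal_sup [set pi_norm S f v | v in [set v | S v /\ gsrc v = v]].
End ReducedNorm.

(* Not assumed unital. *)
Record cstar_algebra (R : realType) := CstarAlgebra {
  cstar_sort :> completeNormedModType R[i];
  cmul : cstar_sort -> cstar_sort -> cstar_sort;
  cinv : cstar_sort -> cstar_sort;
  cmulA : associative cmul;
  cmulDl : left_distributive cmul +%R;
  cmulDr : right_distributive cmul +%R;
  cmulZl : forall c a b, cmul (c *: a) b = c *: cmul a b;
  cmulZr : forall c a b, cmul a (c *: b) = c *: cmul a b;
  cinvK : involutive cinv;
  cinvD : forall a b, cinv (a + b) = cinv a + cinv b;
  cinvZ : forall c a, cinv (c *: a) = c^* *: cinv a;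
  cinvM : forall a b, cinv (cmul a b) = cmul (cinv b) (cinv a);
  cnormM : forall a b, `|cmul a b| <= `|a| * `|b|;
  cnorm_star : forall a, `|cmul (cinv a) a| = `|a| ^+ 2 }.

Definition star_hom (R : realType) (A B : cstar_algebra R) (h : A -> B) : Prop :=
  [/\ forall a b, h (a + b) = h a + h b,
      forall c a, h (c *: a) = c *: h a,
      forall a b, h (cmul a b) = cmul (h a) (h b) &
      forall a, h (cinv a) = cinv (h a)].

(* (A, iota) is a completion of the *-algebra C_c(S) in the reduced norm; this
   determines (A, iota) up to a unique isometric *-isomorphism. *)
Definition reduced_cstar (R : realType) (H : groupoid) (S : set H)
    (A : cstar_algebra R) (iota : (H -> R[i]) -> A) : Prop :=
  [/\ forall f g, Cc S f -> Cc S g -> iota (fun x => f x + g x) = iota f + iota g,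
      forall c f, Cc S f -> iota (fun x => c * f x) = c *: iota f,
      forall f g, Cc S f -> Cc S g -> iota (conv f g) = cmul (iota f) (iota g),
      forall f, Cc S f -> iota (fstar f) = cinv (iota f) &
      (forall f, Cc S f -> rnorm S f = (complex.Re `|iota f|)%:E) /\
      closure (iota @` Cc S) = [set: A]].

Definition quot_alg (R : realType) (A : cstar_algebra R) (J : set A) : Type :=
  {T : set A | exists a, T = [set x | J (x - a)]}.

Definition quot_cls (R : realType) (A : cstar_algebra R) (J : set A) (a : A) :
  quot_alg J := exist _ [set x | J (x - a)] (ex_intro _ a erefl).

(* The operations of A/J are those making quot_cls a *-homomorphism. *)
Definition quot_star_hom (R : realType) (A B : cstar_algebra R) (J : set A)
    (h : quot_alg J -> B) : Prop :=
  star_hom (fun a => h (quot_cls J a)).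

Definition Jr (R : realType) (H : groupoid) (u : H) (A : cstar_algebra R)
    (iota : (H -> R[i]) -> A) : set A :=
  closure (iota @` [set f | Cc (iso_interior H) f /\
                            forall x, iso_interior_at u x -> f x = 0]).

Section F2Kernels.
Variable n : nat.

Definition F2_K_set : set F2 :=
  [set g | forall (D : finGroupType) (phi : F2 -> D),
     {morph phi : x y / (x * y)%g} -> (#|D| <= n)%N -> phi g = 1%g].

Lemma F2_morph1 (D : finGroupType) (phi : F2 -> D) :
  {morph phi : x y / (x * y)%g} -> phi 1%g = 1%g.
Proof. by move=> phiM; apply: (mulgI (phi 1%g)); rewrite -phiM !mulg1. Qed.

Lemma F2_morphV (D : finGroupType) (phi : F2 -> D) x :
  {morph phi : x y / (x * y)%g} -> phi x^-1%g = ((phi x)^-1)%g.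
Proof.
by move=> phiM; apply: (mulgI (phi x)); rewrite -phiM !mulgV F2_morph1.
Qed.

Lemma F2_K1 : F2_K_set 1%g.
Proof. by move=> D phi phiM _; exact: F2_morph1. Qed.
Lemma F2_KM x y : F2_K_set x -> F2_K_set y -> F2_K_set (x * y)%g.
Proof.
by move=> Kx Ky D phi phiM Dn; rewrite phiM (Kx _ _ phiM Dn) (Ky _ _ phiM Dn) mulg1.
Qed.
Lemma F2_KV x : F2_K_set x -> F2_K_set x^-1%g.
Proof.
by move=> Kx D phi phiM Dn; rewrite F2_morphV // (Kx _ _ phiM Dn) invg1.
Qed.
Lemma F2_KJ x y : F2_K_set x -> F2_K_set (x ^ y)%g.
Proof.
move=> Kx D phi phiM Dn.
by rewrite conjgE !phiM F2_morphV // (Kx _ _ phiM Dn) mul1g mulVg.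
Qed.

Definition F2_K : normal_subgroup F2 := NormalSubgroup F2_K1 F2_KM F2_KV F2_KJ.
End F2Kernels.

Definition F2_HLS : groupoid := HLS F2_K.
Definition F2_u : F2_HLS := hls_unit_infty F2_K.

(* Main.v *)
From HB Require Import structures.
Require Import Defs.
From mathcomp Require Import all_boot all_order all_algebra all_fingroup.
From mathcomp Require Import generic_quotient finmap complex.
From mathcomp Require Import all_classical all_reals all_analysis.
From mathcomp Require Import ring lra.
Set Implicit Arguments.
Unset Strict Implicit.
Unset Printing Implicit Defensive.
Import Order.TTheory GRing.Theory Num.Theory.
Import numFieldNormedType.Exports.
Local Open Scope classical_set_scope.
Local Open Scope ring_scope.

(* Let p be the mean of the indicators of the four sections {(n, pi_n(s))},
   s a generator of F_2 or its inverse, and e the indicator of the unit space.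
   Since F_2 is not amenable, p has norm < 1 in the regular representation of F_2
   (Schur's test with the weight 2^(-|g|) gives 7/8), so x |-> E + P x is a
   contraction of the algebra of the fibre at infinity, where E and P are the
   images of e and p; let b be its fixed point. If theta were injective, any a
   lying over b would satisfy a - p a - e in J. But each Gamma_n is finite, so
   its regular representation contains the trivial one, which is a character
   bounded by the reduced norm; it sends p and e to 1, hence a - p a - e to -1,
   whereas on elements of J these characters tend to 0 as n grows. *)

(** * Residual finiteness of [F2] and finiteness of its quotients by [F2_K n] *)

(** [A] and its image have complements of equal size, so the points outside [A] can be matched with
    those outside the image along the two enumerations. *)
Lemma perm_extension (T : finType) (A : {set T}) (f : T -> T) :
  {in A &, injective f} -> exists s : {perm T}, {in A, s =1 f}.
Proof.
move=> injf; pose B := [set f x | x in A]%SET.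
have eqc : #|~: A| = #|~: B|.
  by apply/eqP; rewrite -(eqn_add2l #|A|) cardsC -(card_in_imset injf) cardsC.
pose g x := if x \in A then f x else nth x (enum (~: B)) (index x (enum (~: A))).
have gA x : x \in A -> g x \in B by move=> xA; rewrite /g xA imset_f.
have idx x : x \notin A -> (index x (enum (~: A)) < size (enum (~: B)))%N.
  by move=> xA; rewrite -cardE -eqc cardE index_mem mem_enum inE.
have gNA x : x \notin A -> g x \notin B.
  move=> xA; rewrite /g (negPf xA).
  by have := mem_nth x (idx x xA); rewrite mem_enum inE.
have injg : injective g.
  move=> x y gxy; have xyA : (x \in A) = (y \in A).
    by apply/idP/idP => h; apply: contraTT (gA _ h) => /gNA; rewrite ?gxy // -gxy.
  move: gxy; rewrite /g xyA; case: (boolP (y \in A)) => yA.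
    by apply: injf; rewrite ?xyA.
  have xA : x \notin A by rewrite xyA.
  rewrite (set_nth_default y) ?idx // => /eqP.
  rewrite nth_uniq ?idx ?enum_uniq // => /eqP /(congr1 (nth x (enum (~: A)))).
  by rewrite nth_index ?mem_enum ?inE // nth_index ?mem_enum ?inE.
by exists (perm injg) => x xA; rewrite permE /g xA.
Qed.

(* The j-th letter of w moves the state j to j+1 (as a generator, or as the
   inverse of one that moves j+1 to j); reducedness makes these partial maps
   injective, and they are completed to permutations of {0, ..., size w}. *)
Lemma F2_residually_finite (g : F2) : g != 1%g ->
  exists (D : finGroupType) (phi : F2 -> D),
    {morph phi : x y / (x * y)%g} /\ phi g != 1%g.
Proof.
move=> g1; pose w : seq letter := f2word g; pose k := size w.
pose l0 : letter := (false, false); pose L j := nth l0 w j.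
have redw j : (j.+1 < k)%N -> L j.+1 <> linv (L j).
  move=> jk; have := f2wordP g; rewrite /reduced => /(sortedP l0) /(_ j jk).
  by move/eqP.
pose fwd i (j : nat) := (j < k)%N && (L j == (i, false)).
pose bwd i (j : nat) := (0 < j <= k)%N && (L j.-1 == (i, true)).
pose A i := [set j : 'I_k.+1 | fwd i j || bwd i j]%SET.
pose f i (j : 'I_k.+1) : 'I_k.+1 := inord (if fwd i j then j.+1 else j.-1).
(* A violation of [fb] or [fb2] would put a letter of [w] next to its inverse. [fb] makes the
   partial map of generator [i] single-valued; [fb2] prevents [j] and [j.+2] from both going to
   [j.+1]. *)
have fb i j : fwd i j -> bwd i j -> False.
  move=> /andP[jk /eqP Lj] /andP[/andP[j0 _] /eqP Lj'].
  case: j j0 jk Lj Lj' => // j _ jk Lj Lj'; apply: (redw j jk).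
  by rewrite Lj Lj'.
have fb2 i j : fwd i j -> bwd i j.+2 -> False.
  move=> /andP[jk /eqP Lj] /andP[jk2 /eqP Lj']; apply: (redw j) => //.
  by rewrite Lj Lj'.
have valf i j : j \in A i -> f i j = (if fwd i j then j.+1 else j.-1) :> nat.
  move=> _; rewrite /f inordK //; case: ifP => [/andP[]//|_].
  by rewrite (leq_ltn_trans (leq_pred j)).
have injf i : {in A i &, injective (f i)}.
  move=> x y xA yA fxy; apply: val_inj => /=.
  move: (congr1 val fxy) => /=; rewrite !valf //.
  move: xA yA; rewrite !inE.
  case: (boolP (fwd i x)) => [fx _|_ /= bx]; case: (boolP (fwd i y)) => [fy _|_ /= by_].
  - by case.
  - move=> e; case: (fb2 i x fx); rewrite e prednK //.
    by case/andP: by_ => /andP[].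
  - move=> e; case: (fb2 i y fy); rewrite -e prednK //.
    by case/andP: bx => /andP[].
  - move=> e; case/andP: bx => /andP[x0 _] _; case/andP: by_ => /andP[y0 _] _.
    by rewrite -(prednK x0) -(prednK y0) e.
have [s sE] : exists s : bool -> {perm 'I_k.+1}, forall i, {in A i, s i =1 f i}.
  have h i := perm_extension (@injf i).
  by exists (fun i => projT1 (cid (h i))) => i; exact: projT2 (cid (h i)).
have [phi [[phiM phig] _]] := @F2_universal {perm 'I_k.+1} s.
exists {perm 'I_k.+1}, phi; split => //.
(* A product of permutations applies its left factor first, so [w] is read from its first letter on;
   [u] is the prefix already read and the current state is its length. *)
have step (w' : seq letter) (rw' : reduced w') u : w = u ++ w' ->
    phi (MkF2 rw') (inord (size u)) = inord k.
  elim: w' rw' u => [|[i e] w' IH] rw' u wE.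
    have -> : MkF2 rw' = 1%g by exact: val_inj.
    rewrite (F2_morph1 phiM) perm1; congr inord.
    by rewrite /k wE cats0.
  have uk : (size u < k)%N by rewrite /k wE size_cat /= -addSnnS leq_addr.
  have Lu : L (size u) = (i, e) by rewrite /L wE nth_cat ltnn subnn.
  rewrite f2_push phiM permM /=.
  have -> : phi (if e then (f2gen i)^-1%g else f2gen i) (inord (size u))
    = inord (size u).+1.
    case: e Lu {IH rw' wE} => Lu; last first.
      have fu : fwd i (size u) by rewrite /fwd uk Lu eqxx.
      have uA : inord (size u) \in A i by rewrite inE inordK ?fu // ltnW.
      by rewrite phig sE //; apply: val_inj; rewrite /= valf // !inordK ?fu // ltnW.
    have bu : bwd i (size u).+1 by rewrite /bwd /= uk Lu eqxx.
    have uA : inord (size u).+1 \in A i by rewrite inE inordK ?bu ?orbT.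
    rewrite (F2_morphV _ phiM) phig; apply: (canLR (permK _)); rewrite sE //.
    apply: val_inj; rewrite /= valf // !inordK ?ltnS //; last exact: ltnW.
    by case: ifP => // /fb /(_ bu).
  have := IH (reduced_tl rw') (rcons u (i, e)).
  by rewrite size_rcons; apply; rewrite cat_rcons.
(* For the empty prefix, [phi g] sends 0 to [k]; were it trivial, [k] would be 0 and [g] the empty
   word. *)
apply/eqP => phi1; have := step _ (f2wordP g) [::] erefl.
have -> : MkF2 (f2wordP g) = g by exact: val_inj.
rewrite phi1 perm1 => /(congr1 val); rewrite /= !inordK // => k0.
case/eqP: g1; apply: val_inj; rewrite /=; apply: size0nil.
by rewrite -/w -/k -k0.
Qed.

Lemma F2_K_le m n (x : F2) : (m <= n)%N -> nsset (F2_K n) x -> nsset (F2_K m) x.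
Proof. by move=> mn Kx D phi phiM Dm; apply: Kx => //; exact: leq_trans mn. Qed.

(** One finite group [D] detecting [x] suffices, since the subgroups decrease: every index from
    [#|D|] on works. *)
Lemma F2_K_separates (x : F2) : x != 1%g ->
  exists N, forall n, (N <= n)%N -> ~ nsset (F2_K n) x.
Proof.
move=> /F2_residually_finite[D [phi [phiM /eqP phix]]]; exists #|D| => n Dn.
by move=> /(F2_K_le Dn) Kx; apply: phix; exact: Kx.
Qed.

(* An element g of F2 acts on any group of order at most n as a composite of
   self-maps of {0, ..., n-1}, one per letter, so its class modulo K_n is
   determined by the composites of all 4-tuples of such self-maps. *)
Lemma F2_quotient_finite n : finite_set [set: quotg (F2_K n)].
Proof.
pose ev (c : {ffun letter -> {ffun 'I_n -> 'I_n}}) (w : seq letter) (i : 'I_n) :=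
  foldr (fun x j => c x j) i w.
pose code (q : quotg (F2_K n)) := [ffun c => [ffun i => ev c (f2word (repr q)) i]].
suff injc : injective code.
  have : finite_set (code @^-1` [set: {ffun _ -> {ffun 'I_n -> 'I_n}}]).
    by apply: finite_preimage; [by move=> x y _ _; exact: injc | exact: finite_finset].
  by rewrite preimage_setT.
move=> q q' /ffunP qq'; rewrite -[q]quotg_repr -[q']quotg_repr.
apply/quotg_piP => D phi phiM Dn.
pose rk (d : D) : 'I_n := widen_ord Dn (enum_rank d).
pose l (x : letter) : F2 := if x.2 then (f2gen x.1)^-1%g else f2gen x.1.
(* [c] transports left multiplication by the images of the letters to the first [#|D|] points of
   ['I_n] and fixes the remaining points. *)
pose c : {ffun letter -> {ffun 'I_n -> 'I_n}} := [ffun x : letter => [ffun i : 'I_n =>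
  if insub (i : nat) is Some j then rk (phi (l x) * enum_val (j : 'I_#|D|))%g else i]].
have crk x d : c x (rk d) = rk (phi (l x) * d)%g.
  by rewrite !ffunE (valK (enum_rank d)) enum_rankK.
have evc (w : seq letter) (rw : reduced w) : ev c w (rk 1%g) = rk (phi (MkF2 rw)).
  elim: w rw => [|x w IH] rw.
    by rewrite (_ : MkF2 rw = 1%g) ?(F2_morph1 phiM) //; exact: val_inj.
  by rewrite f2_push phiM -/(l x) /= (IH (reduced_tl rw)) crk.
have evg (g : F2) : ev c g (rk 1%g) = rk (phi g).
  by rewrite (evc _ (f2wordP g)); congr (rk (phi _)); exact: val_inj.
have rk_inj : injective rk.
  by move=> d d' /(congr1 val) /= h; apply: enum_rank_inj; exact: val_inj.
have /rk_inj : rk (phi (repr q)) = rk (phi (repr q')).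
  by rewrite -!evg; move: (qq' c) => /ffunP /(_ (rk 1%g)); rewrite !ffunE.
rewrite phiM F2_morphV // => ->; exact: mulVg.
Qed.

(** * Topology of the HLS groupoid and translation by sections *)

Section HLSTopology.
Variables (G : groupType) (K : nat -> normal_subgroup G).

Definition hls_sec (g : G) (m : option nat) : hls K := hlsE (hls_pi K m g).

Lemma hlsE_inj n : injective (@hlsE G K n).
Proof.
by move=> q q' /(congr1 (tagged_as (hlsE q))); rewrite /hlsE !tagged_asE.
Qed.

Lemma open_hls_generator (B : set (hls K)) : hls_generators B -> open B.
Proof.
move=> KB; exists [set B]; last by rewrite bigcup_set1.
by move=> _ ->; exact: (finI_from1 id).
Qed.

Lemma nbhs_hls_finite n (q : hls_fiber K (Some n)) (U : set (hls K)) :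
  nbhs (hlsE q) U <-> U (hlsE q).
Proof.
split; first exact: nbhs_singleton.
move=> Uq; rewrite nbhsE; exists [set hlsE q]; last by move=> _ ->.
by split=> //; apply: open_hls_generator; left; exists n, q.
Qed.

(** A subbasic set through the point [g] at infinity must be a tail of the section of [g] itself,
    because [hls_pi] is the identity there; a finite intersection of such tails contains the tail
    beyond the largest threshold. *)
Lemma nbhs_hls_infty (g : G) (U : set (hls K)) :
  nbhs (hls_sec g None) U <->
  exists N, forall m, idx_gt N m -> U (hls_sec g m).
Proof.
split=> [|[N NU]]; last first.
  rewrite nbhsE; exists [set hls_sec g n | n in [set n | idx_gt N n]].
    split; last by exists None.
    by apply: open_hls_generator; right; exists g, N.
  by move=> _ [m /NU ? <-].
rewrite nbhsE => -[_ [[D' D'sub <-] [V D'V Vg]] BU].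
have {}BU : V `<=` U by move=> x Vx; apply: BU; exists V.
have {D'V D'sub} : finI_from (@hls_generators G K) id (V : set (hls K)).
  exact: D'sub V D'V.
move=> [E Egen EV]; move: Vg BU EV.
change ((V : set (hls K)) (hls_sec g None) -> (V : set (hls K)) `<=` U ->
  \bigcap_(i in [set` E]) i = (V : set (hls K)) ->
  exists N, forall m, idx_gt N m -> U (hls_sec g m)).
move: (V : set (hls K)) => {}V Vg BU EV.
suff [N NV] : exists N, forall m, idx_gt N m -> V (hls_sec g m).
  by exists N => m /NV Vm; apply: BU.
have {}EV : forall x, V x <-> forall B', B' \in E -> B' x.
  by move=> x; rewrite -EV.
have Eg : forall B', B' \in E -> exists N, forall m, idx_gt N m -> B' (hls_sec g m).
  move=> B' EB'; have /EV /(_ _ EB') := Vg.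
  case: (Egen _ EB') => /set_mem [[n [q ->]]|[g' [N ->]]].
    by move=> /(congr1 tag).
  move=> [[m|] _ e]; first by have := congr1 tag e.
  have -> : g = g' :> G by exact: (@hlsE_inj None _ _ (esym e)).
  by exists N => m mN; exists m.
pose F (B' : set (hls K)) :=
  xget 0%N [set N | forall m, idx_gt N m -> B' (hls_sec g m)].
exists (\max_(B' <- finmap.enum_fset E) F B') => m mN; apply/EV => B' EB'.
have /Eg/cid[N0 N0P] := EB'.
have /= := xgetPex 0%N
  (ex_intro (fun N => forall m, idx_gt N m -> B' (hls_sec g m)) N0 N0P).
apply; case: m mN => //= m; apply: leq_ltn_trans.
exact: leq_bigmax_seq.
Qed.

Lemma hls_secP (x : hls K) : exists g, x = hls_sec g (tag x).
Proof.
case: x => -[n|] q; last by exists q.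
by exists (repr q); congr existT; rewrite /= quotg_repr.
Qed.

(** Points of the finite fibres are isolated, so only the points at infinity impose a condition. *)
Lemma hls_continuousP (T : topologicalType) (f : hls K -> T) :
  continuous f <-> forall g U, nbhs (f (hls_sec g None)) U ->
    exists N, forall m, idx_gt N m -> U (f (hls_sec g m)).
Proof.
split=> [cf g U Uf|h [[n|] q]]; first exact/(nbhs_hls_infty g (f @^-1` U))/cf.
  by move=> U Uf; apply/nbhs_hls_finite; exact: nbhs_singleton Uf.
by move=> U /h Uf; exact/(nbhs_hls_infty q (f @^-1` U)).
Qed.

(** A section is a sequence together with its limit: a filter on it either clusters at the limit or
    contains a finite set of terms. *)
Lemma compact_hls_sec g : compact (range (hls_sec g)).
Proof.
move=> F PF Fg; case: (pselect (cluster F (hls_sec g None))) => [clg|nclg].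
  by exists (hls_sec g None); split=> //; exists None.
have [A [B [FA /nbhs_hls_infty[N NB] AB]]] :
    exists A B, [/\ F A, nbhs (hls_sec g None) B & ~ (A `&` B !=set0)].
  apply: contrapT => h; apply: nclg => A B FA gB; apply: contrapT => AB.
  by apply: h; exists A, B.
pose D := [set hls_sec g (Some n) | n in `I_N.+1].
have FD : F D.
  apply: filterS (filterI Fg FA) => _ [[m _ <-] Ax].
  have mN : ~ idx_gt N m by move=> /NB Bx; apply: AB; exists (hls_sec g m).
  case: m mN {Ax} => [n|] //= /negP nN; exists n => //=.
  by rewrite ltnS leqNgt.
have /finite_compact/(_ F PF FD)[x [[n _ <-] clx]] : finite_set D.
  by apply: finite_image; exact: finite_II.
by exists (hls_sec g (Some n)); split=> //; exists (Some n).
Qed.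

HB.instance Definition _ := isPointed.Build (hls K) (hls_sec 1%g None).

(** Cover by singletons in the finite fibres and by sections through the points at infinity. In a
    finite subcover the sections provide [s], and the levels of the singletons are bounded by
    [N]. *)
Lemma compact_hls_bound (C : set (hls K)) : compact C ->
  exists (s : seq G) (N : nat), forall n (q : hls_fiber K (Some n)), (N < n)%N ->
    C (hlsE q) -> exists2 g, g \in s & hlsE q = hls_sec g (Some n).
Proof.
rewrite compact_cover => Ccov.
pose f (x : hls K) : set (hls K) := match x with
  | existT (Some n) q => [set hlsE q]
  | existT None g => [set hls_sec g n | n in [set n | idx_gt 0 n]] end.
have [|x _|D _ CD] := Ccov _ setT f.
- move=> [[n|] q] _; apply: open_hls_generator; first by left; exists n, q.
  by right; exists q, 0%N.
- by exists x => //; case: x => -[n|] q //=; exists None.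
pose t (x : hls K) := if tag x is Some n then n else 0%N.
pose r (x : hls K) : option G := if x is existT None g then Some g else None.
exists (pmap r (finmap.enum_fset D)), (\max_(x <- finmap.enum_fset D) t x) => n q nN.
move=> /CD[[[k|] q'] /= Dx fx].
  have : (k <= \max_(x <- finmap.enum_fset D) t x)%N.
    exact: (leq_bigmax_seq (F := t) _ Dx).
  move=> /leq_ltn_trans /(_ nN); rewrite ltnNge => /negP []; apply: eq_leq.
  by by have /= [->] := congr1 tag fx.
case: fx => -[m|] _ e; last by have := congr1 tag e.
have /= [mn] := congr1 tag e.
subst m; exists q'; last exact: esym e.
by rewrite mem_pmap; apply/mapP; exists (existT _ None q').
Qed.

Lemma hls_piM m (x y : G) : hls_pi K m (x * y)%g = (hls_pi K m x * hls_pi K m y)%g.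
Proof. by case: m => [n|] //=; rewrite -quotg_pi_mul. Qed.

Lemma hls_pi1 m : hls_pi K m 1%g = 1%g.
Proof. by case: m. Qed.

(** One action of [G] on all fibres at once; convolution with the indicator of the section of [s] is
    composition with the translation by the inverse of [s]. *)
Definition hls_lmul (s : G) (x : hls K) : hls K :=
  hlsE (hls_pi K (tag x) s * tagged x)%g.

Lemma hls_lmul_sec s g m : hls_lmul s (hls_sec g m) = hls_sec (s * g)%g m.
Proof. by rewrite /hls_lmul /hls_sec /= -hls_piM. Qed.

Lemma hls_lmul1 x : hls_lmul 1%g x = x.
Proof. by have [g ->] := hls_secP x; rewrite hls_lmul_sec mul1g. Qed.

Lemma hls_lmulM s t x : hls_lmul s (hls_lmul t x) = hls_lmul (s * t)%g x.
Proof.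
by have [g ->] := hls_secP x; rewrite !hls_lmul_sec mulgA.
Qed.

Lemma hls_lmulK s : cancel (hls_lmul s) (hls_lmul s^-1%g).
Proof. by move=> x; rewrite hls_lmulM mulVg hls_lmul1. Qed.

Lemma hls_lmulVK s : cancel (hls_lmul s^-1%g) (hls_lmul s).
Proof. by move=> x; rewrite hls_lmulM mulgV hls_lmul1. Qed.

Lemma hls_lmul_continuous s : continuous (hls_lmul s).
Proof.
apply/hls_continuousP => g U; rewrite hls_lmul_sec => /nbhs_hls_infty[N NU].
by exists N => m /NU; rewrite hls_lmul_sec.
Qed.

End HLSTopology.

(** * Moduli of complex numbers and scaling of sums *)

Lemma Re_norm (R : rcfType) (z : R[i]) : complex.Re `|z| = Normc.normc z.
Proof. by rewrite normc_def; case: z. Qed.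

Lemma complex_norm (R : rcfType) (z : R[i]) : `|z| = (Normc.normc z)%:C%C.
Proof. by rewrite normc_def; case: z. Qed.

Lemma normc_ge0 (R : rcfType) (z : R[i]) : 0 <= Normc.normc z.
Proof. by case: z => u v; exact: sqrtr_ge0. Qed.

Lemma normc_real (R : rcfType) (c : R) : 0 <= c -> Normc.normc c%:C%C = c.
Proof. by move=> c0; rewrite /= expr0n /= addr0 sqrtr_sqr ger0_norm. Qed.

Lemma le_esumZ (R : realType) (T : choiceType) (I : set T) (c : R)
    (a : T -> \bar R) : 0 <= c -> (forall i, 0 <= a i)%E ->
  (\esum_(i in I) (c%:E * a i) <= c%:E * \esum_(i in I) a i)%E.
Proof.
move=> c0 a0; apply: ge_ereal_sup => /= _ [X [finX XI] <-].
rewrite -ge0_mule_fsumr //; apply: lee_wpmul2l; first by rewrite lee_fin.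
by apply: ereal_sup_ubound; exists X.
Qed.

(** * Convolution on the HLS groupoid *)

Section Conv.
Variables (G : groupType) (K : nat -> normal_subgroup G) (R : realType).
Implicit Types f g : hls K -> R[i].

Lemma conv_hlsE f g n (q : hls_fiber K n) :
  @Defs.conv R (HLS K) f g (hlsE q) =
  \sum_(a \in [set: hls_fiber K n]) f (hlsE a) * g (hlsE (a^-1 * q)%g).
Proof.
rewrite /Defs.conv.
rewrite (reindex_fsbig (fun a : hls_fiber K n => (hlsE a, hlsE (a^-1 * q)%g))
  [set: hls_fiber K n]) //.
split.
- by move=> a _ /=; rewrite hls_mulE mulKVg.
- by move=> a b _ _ [] /(@hlsE_inj _ _ _).
move=> [[m a] [m' b]] /= [/hls_unit_tag /= mm' ab]; subst m'.
have /= mn := congr1 tag ab; subst m.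
exists a => //; move: ab; rewrite (hls_mulE a b) => /(@hlsE_inj _ _ _) <-.
by rewrite mulKg.
Qed.

(** Distinct [t s] may coincide in a quotient, so the hypothesis counts masses with multiplicity.
    Listing the images once in [r] and exchanging the two sums leaves one term for each [s]. *)
Lemma conv_point_masses (I : finType) (t : I -> G) (c : R[i]) f g n
    (q : hls_fiber K n) :
  (forall a : hls_fiber K n,
     f (hlsE a) = \sum_(s : I) (if a == hls_pi K n (t s) then c else 0)) ->
  @Defs.conv R (HLS K) f g (hlsE q) =
  \sum_(s : I) c * g (hls_lmul (t s)^-1%g (hlsE q)).
Proof.
move=> fE; rewrite conv_hlsE.
pose r := undup [seq hls_pi K n (t s) | s : I].
have tr s : hls_pi K n (t s) \in r.
  by rewrite mem_undup; apply/mapP; exists s; rewrite ?mem_enum.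
rewrite (fsbigE r) ?undup_uniq //; last first.
  move=> a _ ar; rewrite fE big1 ?mul0r // => s _; case: eqP => // e.
  by rewrite e tr in ar.
under eq_bigl do rewrite in_setT.
under eq_bigr => a _ do rewrite fE mulr_suml.
rewrite exchange_big /=; apply: eq_bigr => s _.
rewrite (bigD1_seq (hls_pi K n (t s))) ?undup_uniq //= eqxx big1 ?addr0.
  congr (_ * g (hlsE (_ * _)%g)).
  by apply: (mulgI (hls_pi K n (t s))); rewrite -hls_piM !mulgV hls_pi1.
by move=> a /negPf ->; rewrite mul0r.
Qed.

End Conv.

(** * Schur's test for the mean of the letters on the fibre at infinity *)

Definition letter_elt (x : letter) : F2 :=
  if x.2 then (f2gen x.1)^-1%g else f2gen x.1.

Lemma letter_elt_linv x : letter_elt (linv x) = (letter_elt x)^-1%g.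
Proof. by case: x => i [] /=; rewrite /letter_elt /= ?invgK. Qed.

Lemma letter_eltM x (g : F2) : f2word (letter_elt x * g)%g = push x (f2word g).
Proof. by case: x => i []. Qed.

(** On a nonempty word one letter cancels, doubling the weight, and the three others lengthen the
    word, halving it: 2 + 3/2 = 7/2. The empty word gives only 4/2. *)
Lemma sum_push_weight (R : realFieldType) (w : seq letter) :
  \sum_(x : letter) 2^-1 ^+ size (push x w) <= 7 / 2 * 2^-1 ^+ size w :> R.
Proof.
have sumc (P : pred letter) (c : R) : \sum_(x | P x) c = #|P|%:R * c.
  by rewrite sumr_const mulr_natl.
case: w => [|y w] /=.
  under eq_bigr do rewrite expr1.
  by rewrite sumc card_prod card_bool expr0; lra.
rewrite (bigD1 (linv y)) //= linvK eqxx.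
under eq_bigr => x xy.
  rewrite (_ : y == linv x = false); last first.
    by apply: contraNF xy => /eqP ->; rewrite linvK.
  over.
have -> : \sum_(x | x != linv y) 2^-1 ^+ (size w).+2 = 3 * 2^-1 ^+ (size w).+2 :> R.
  rewrite (sumc (fun x => x != linv y)); congr (_%:R * _).
  by have := cardC1 (linv y); rewrite card_prod card_bool.
have : 0 <= 2^-1 ^+ size w :> R by rewrite exprn_ge0 // invr_ge0.
rewrite !exprS; lra.
Qed.

(* The w-weighted variance of a/w is nonnegative. *)
Lemma weighted_cauchy_schwarz (R : realFieldType) (I : finType) (a w : I -> R) :
  (forall s, 0 < w s) ->
  (\sum_s a s) ^+ 2 <= (\sum_s w s) * \sum_s (a s ^+ 2 / w s).
Proof.
move=> w0; have [i0 _|noI] := pickP (@predT I); last first.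
  by rewrite !big_pred0 // expr0n mul0r.
set A := \sum_s a s; set W := \sum_s w s; set Q := \sum_s _.
have W0 : 0 < W.
  rewrite /W (bigD1 i0) //=; apply: ltr_pwDl => //.
  by apply: sumr_ge0 => s _; exact: ltW.
have : 0 <= \sum_s (a s * W - A * w s) ^+ 2 / w s.
  by apply: sumr_ge0 => s _; rewrite divr_ge0 ?sqr_ge0 // ltW.
have -> : \sum_s (a s * W - A * w s) ^+ 2 / w s = W * (W * Q - A ^+ 2).
  transitivity (\sum_s (W ^+ 2 * (a s ^+ 2 / w s) - 2 * W * A * a s + A ^+ 2 * w s)).
    by apply: eq_bigr => s _; field; rewrite gt_eqF.
  by rewrite !big_split /= sumrN -!mulr_sumr -/A -/W -/Q; ring.
by rewrite pmulr_rge0 // subr_ge0.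
Qed.

Section Schur.
Variable (R : realType).
Implicit Types (f xi : hls F2_K -> R[i]) (x : hls F2_K).

Definition letter_avg xi x : R[i] :=
  \sum_(s : letter) 4^-1 * xi (hls_lmul (letter_elt s)^-1%g x).

(** The Schur weight at infinity; the value 1 on the finite fibres keeps it positive everywhere. *)
Definition hls_weight x : R :=
  if x is existT None g then 2^-1 ^+ size (f2word g) else 1.

Lemma hls_weight_gt0 x : 0 < hls_weight x.
Proof. by case: x => -[n|] g //=; rewrite exprn_gt0 // invr_gt0. Qed.

Lemma hls_weight_ge0 x : 0 <= hls_weight x.
Proof. exact/ltW/hls_weight_gt0. Qed.

Lemma sum_hls_weight x : tag x = None ->
  \sum_(s : letter) hls_weight (hls_lmul (letter_elt s) x) <= 7 / 2 * hls_weight x.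
Proof.
case: x => -[//|] g _; apply: le_trans (sum_push_weight R (f2word g)).
by apply: ler_sum => s _; rewrite -letter_eltM.
Qed.

Lemma sum_hls_weightV x : tag x = None ->
  \sum_(s : letter) hls_weight (hls_lmul (letter_elt s)^-1%g x)
  <= 7 / 2 * hls_weight x.
Proof.
move=> /sum_hls_weight; rewrite (reindex_inj (inv_inj linvK)) /=.
by under eq_bigr do rewrite letter_elt_linv.
Qed.

(** Cauchy-Schwarz with the translated weights, whose sum is at most 7/2 times the weight at [x];
    the squared factor 1/4 turns this into 7/32. *)
Lemma letter_avg_pointwise xi x : (forall y, tag y != None -> xi y = 0) ->
  Normc.normc (letter_avg xi x) ^+ 2 <=
  \sum_(s : letter) 7 / 32 * (hls_weight x *
     Normc.normc (xi (hls_lmul (letter_elt s)^-1%g x)) ^+ 2 /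
       hls_weight (hls_lmul (letter_elt s)^-1%g x)).
Proof.
move=> xi0; have [xN|xN] := eqVneq (tag x) None; last first.
  rewrite /letter_avg big1 => [|s _]; last by rewrite xi0 ?mulr0.
  rewrite Normc.normc0 expr0n; apply: sumr_ge0 => s _.
  by rewrite xi0 // Normc.normc0 expr0n /= mulr0 mul0r mulr0.
pose a (s : letter) := Normc.normc (xi (hls_lmul (letter_elt s)^-1%g x)).
pose w (s : letter) := hls_weight (hls_lmul (letter_elt s)^-1%g x).
have CS := weighted_cauchy_schwarz a
  (fun s => hls_weight_gt0 (hls_lmul (letter_elt s)^-1%g x)).
have le1 : Normc.normc (letter_avg xi x) <= 4^-1 * \sum_s a s.
  rewrite /letter_avg -mulr_sumr Normc.normcM.
  have -> : Normc.normc (4^-1 : R[i]) = 4^-1.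
    by rewrite -(rmorph_nat (real_complex R)) -fmorphV normc_real // invr_ge0.
  rewrite ler_pM2l ?invr_gt0 //.
  elim/big_ind2: _ => //; first by rewrite Normc.normc0.
  move=> z1 r1 z2 r2 h1 h2; apply: le_trans (lerD h1 h2); exact: le_normcD.
have Q0 : 0 <= \sum_s a s ^+ 2 / w s.
  by apply: sumr_ge0 => s _; rewrite divr_ge0 ?sqr_ge0 // hls_weight_ge0.
have : Normc.normc (letter_avg xi x) ^+ 2 <=
    16^-1 * (7 / 2 * hls_weight x * \sum_s a s ^+ 2 / w s).
  have -> : 16^-1 = 4^-1 ^+ 2 :> R by field.
  apply: (@le_trans _ _ ((4^-1 * \sum_s a s) ^+ 2)).
    rewrite ler_sqr ?nnegrE ?normc_ge0 ?mulr_ge0 ?invr_ge0 //.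
    by apply: sumr_ge0 => s _; exact: normc_ge0.
  rewrite exprMn ler_pM2l ?exprn_gt0 ?invr_gt0 //; apply: le_trans CS _.
  by apply: ler_wpM2r => //; exact: sum_hls_weightV.
move=> /le_trans; apply; rewrite -mulr_sumr.
under [X in _ <= _ * X]eq_bigr => s _ do rewrite -mulrA.
by rewrite -mulr_sumr -/w -/a; lra.
Qed.

(** After summing the pointwise bound over [x], translating the term of each [s] by [letter_elt s]
    lets the weight inequality act a second time: 7/32 * 7/2 = 49/64 = (7/8)^2. *)
Lemma letter_avg_bound xi : (forall y, tag y != None -> xi y = 0) ->
  (@l2norm R F2_HLS xi <= 1)%E -> (@l2norm R F2_HLS (letter_avg xi) <= (7 / 8)%:E)%E.
Proof.
move=> xi0; rewrite /l2norm.
set N := esum _ _ => N1.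
have N0 : (0 <= N)%E by apply: esum_ge0 => x _; rewrite lee_fin sqr_ge0.
have {}N1 : (N <= 1)%E.
  by rewrite -lee_sqrt // /sqrte sqrtr1.
suff : (\esum_(x in [set: hls F2_K]) ((Normc.normc (letter_avg xi x)) ^+ 2)%:E
    <= (49 / 64)%:E * N)%E.
  move=> le2; have -> : (7 / 8)%:E = sqrte (49 / 64)%:E :> \bar R.
    rewrite /sqrte (_ : 49 / 64 = (7 / 8) ^+ 2 :> R); last by field.
    by rewrite sqrtr_sqr ger0_norm //; lra.
  rewrite lee_sqrt ?lee_fin; last by lra.
  apply: (le_trans (y := ((49 / 64)%:E * N)%E)).
    by apply: le_trans le2; apply: le_esum => x _; rewrite Re_norm.
  by rewrite -[leRHS]mule1; apply: lee_wpmul2l => //; rewrite lee_fin divr_ge0.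
pose F (s : letter) (x : hls F2_K) : R := 7 / 32 *
  (hls_weight (hls_lmul (letter_elt s) x) * Normc.normc (xi x) ^+ 2 / hls_weight x).
have F0 s x : 0 <= F s x.
  apply: mulr_ge0; first by lra.
  by rewrite divr_ge0 ?mulr_ge0 ?normc_ge0 ?hls_weight_ge0.
pose F' s x := F s (hls_lmul (letter_elt s)^-1%g x).
apply: (@le_trans _ _ (\esum_(x in [set: hls F2_K]) \sum_(s : letter) (F' s x)%:E)%E).
  apply: le_esum => x _; rewrite sumEFin lee_fin.
  apply: le_trans (letter_avg_pointwise x xi0) _; apply: ler_sum => s _.
  by rewrite /F' /F hls_lmulVK.
rewrite esum_sum; last by move=> x s _ _; rewrite lee_fin; exact: F0.
have -> : (\sum_(s : letter) \esum_(x in [set: hls F2_K]) (F' s x)%:E =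
  \sum_(s : letter) \esum_(x in [set: hls F2_K]) (F s x)%:E)%E.
  apply: eq_bigr => s _.
  rewrite (reindex_esum [set: hls F2_K] setT (hls_lmul (letter_elt s))) //; last first.
    split=> // [x y _ _|y _]; first exact: (can_inj (hls_lmulK _)).
    by exists (hls_lmul (letter_elt s)^-1%g y) => //; rewrite hls_lmulVK.
  by apply: eq_esum => x _; rewrite /F' hls_lmulK.
rewrite -esum_sum; last by move=> x s _ _; rewrite lee_fin; exact: F0.
have c0 : 0 <= 49 / 64 :> R by lra.
have sq0 (x : hls F2_K) : (0 <= ((complex.Re `|xi x|) ^+ 2)%:E)%E.
  by rewrite lee_fin sqr_ge0.
apply: le_trans (le_esumZ setT c0 sq0).
apply: le_esum => x _; rewrite sumEFin -EFinM lee_fin Re_norm.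
have [xN|xN] := eqVneq (tag x) None; last first.
  rewrite big1 => [|s _]; first by rewrite mulr_ge0 ?sqr_ge0 ?normc_ge0.
  by rewrite /F xi0 // Normc.normc0 expr0n /= !(mulr0, mul0r).
rewrite /F -mulr_sumr -!mulr_suml.
have w0 := hls_weight_gt0 x; have := sum_hls_weight xN.
set S := \sum_s _ => Sle.
have -> : 49 / 64 * Normc.normc (xi x) ^+ 2 =
   7 / 32 * ((7 / 2 * hls_weight x) * Normc.normc (xi x) ^+ 2 / hls_weight x).
  by field; rewrite gt_eqF.
rewrite ler_pM2l; last by lra.
by rewrite !ler_wpM2r ?invr_ge0 ?hls_weight_ge0 ?sqr_ge0.
Qed.
End Schur.

(** * The trivial representation on a finite fibre *)

Section FiberSum.
Variables (G : groupType) (K : nat -> normal_subgroup G) (R : realType).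
Variables (n : nat) (finK : finite_set [set: quotg (K n)]).
Implicit Types f g : hls K -> R[i].

Definition fiber_sum f : R[i] :=
  \sum_(a \in [set: hls_fiber K (Some n)]) f (hlsE a).

Lemma fiber_sumD f g : fiber_sum (fun x => f x + g x) = fiber_sum f + fiber_sum g.
Proof. exact: fsbig_split. Qed.

Lemma fiber_sumZ c f : fiber_sum (fun x => c * f x) = c * fiber_sum f.
Proof. by rewrite /fiber_sum fsbig_distrr. Qed.

Lemma fiber_sum_lmul s f : fiber_sum (fun x => f (hls_lmul s x)) = fiber_sum f.
Proof.
rewrite [RHS]/fiber_sum.
rewrite (reindex_fsbigT (fun a : hls_fiber K (Some n) => hls_pi K (Some n) s * a)%g) //.
exists (fun a => (hls_pi K (Some n) s)^-1 * a)%g => a; [exact: mulKg | exact: mulKVg].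
Qed.

Lemma fiber_sum_unit : fiber_sum (fun x => (x == hls_sec K 1%g (tag x))%:R) = 1.
Proof.
rewrite /fiber_sum (fsbigD1 (1%g : hls_fiber K (Some n))) //= eqxx fsbig1 ?addr0 //.
move=> a [_ /= a1]; case: eqP => // e.
by case: a1; exact: (@hlsE_inj _ _ _ _ _ e).
Qed.

(* The constant functions on the fibre Gamma_n: convolution by f multiplies them
   by fiber_sum f, i.e. they carry the trivial representation. *)
Lemma conv_fiber_cst f (c : R[i]) :
  @Defs.conv R (HLS K) f (fun x => if tag x == Some n then c else 0) =
  (fun x => if tag x == Some n then fiber_sum f * c else 0).
Proof.
apply/funext => -[m q]; rewrite -/(hlsE q) conv_hlsE /=.
case: eqP => [mn|_]; last by rewrite fsbig1 // => a _; rewrite mulr0.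
subst m; rewrite /fiber_sum !fsbig_finite // mulr_suml.
by apply: eq_bigr => a _.
Qed.

Let N : nat := #|` fset_set [set: quotg (K n)]|%fset.

Lemma l2norm_fiber_cst (c : R[i]) :
  @l2norm R (HLS K) (fun x => if tag x == Some n then c else 0) =
  (Num.sqrt N%:R * Normc.normc c)%:E.
Proof.
rewrite /l2norm.
have -> : \esum_(x in [set: HLS K])
    ((complex.Re `|if tag x == Some n then c else 0|) ^+ 2)%:E =
    (N%:R * Normc.normc c ^+ 2)%:E.
  pose S := [set x : hls K | tag x = Some n].
  transitivity (\esum_(x in S) (Normc.normc c ^+ 2)%:E).
    rewrite [RHS]esum_mkcond; apply: eq_esum => x _; rewrite Re_norm.
    case: eqP => [h|h]; first by rewrite mem_set.
    by rewrite memNset // Normc.normc0 expr0n.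
  rewrite (reindex_esum [set: hls_fiber K (Some n)] S (@hlsE _ _ _)); last first.
    split=> // [a b _ _|[m a] /= mn]; first exact: hlsE_inj.
    by rewrite /S /= in mn; subst m; exists a.
  rewrite esum_fset //; last by move=> *; rewrite lee_fin sqr_ge0.
  rewrite fsbig_finite //= sumEFin; congr EFin.
  by rewrite big_const_seq count_predT iter_addr_0 mulr_natl.
by rewrite /sqrte sqrtrM // sqrtr_sqr ger0_norm // normc_ge0.
Qed.

(** The constant function on the fibre, normalised to norm 1, is an eigenvector of convolution by
    [f] with eigenvalue [fiber_sum f]. *)
Lemma normc_fiber_sum_le f (S : set (HLS K)) : S = setT ->
  ((Normc.normc (fiber_sum f))%:E <= @rnorm R (HLS K) S f)%E.
Proof.
move=> ->; pose v : HLS K := hls_sec K 1%g (Some n).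
have N0 : 0 < N%:R :> R.
  rewrite ltr0n cardfs_gt0; apply/fset0Pn; exists 1%g.
  by rewrite in_fset_set // inE.
pose c : R[i] := ((Num.sqrt N%:R)^-1)%:C%C.
have cE : Normc.normc c = (Num.sqrt N%:R)^-1 by rewrite normc_real // invr_ge0 sqrtr_ge0.
have s0 : Num.sqrt N%:R != 0 :> R by rewrite gt_eqF // sqrtr_gt0.
pose xi (x : HLS K) := if tag x == Some n then c else 0.
apply: (@le_trans _ _ (@pi_norm R (HLS K) setT f v)); last first.
  by apply: ereal_sup_ubound; exists v => //; split=> //; rewrite /= /hls_unit /v hls_pi1.
apply: ereal_sup_ubound; exists xi; last first.
  by rewrite conv_fiber_cst l2norm_fiber_cst Normc.normcM cE mulrCA divff ?mulr1.
split; last by rewrite l2norm_fiber_cst cE divff.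
move=> x h; rewrite /xi; case: eqP => // tx; case: h; split=> //=.
by case: x tx => m q /= mn; subst m; rewrite /hls_unit /v /=.
Qed.
End FiberSum.

(** * Fixed points of affine contractions in a C*-algebra *)

Section Contraction.
Variables (R : realType) (B : cstar_algebra R).
Implicit Types x y P E : B.

Let nr x : R := complex.Re `|x|.

Let nrE x : `|x| = (nr x)%:C%C.
Proof. by apply/esym/RRe_real/normr_real. Qed.

(** There need not be a unit to make sense of the inverse of 1 - P, so the solution is built as the
    limit of the iterates from 0, which are the partial sums of the Neumann series applied to
    [E]. *)
Lemma cmul_affine_fixpoint P E : `|P| < 1 -> exists b, b = E + cmul P b.
Proof.
move=> P1; pose q := nr P.
have nr_ge0 x : 0 <= nr x by rewrite -lecR -nrE; exact: normr_ge0.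
have q1 : q < 1 by rewrite -ltcR -nrE.
have nrN x : nr (- x) = nr x by rewrite /nr normrN.
have nrM x : nr (cmul P x) <= q * nr x.
  by rewrite -lecR rmorphM /= -!nrE; exact: cnormM.
have nrD x y : nr (x + y) <= nr x + nr y.
  by rewrite -lecR rmorphD /= -!nrE; exact: ler_normD.
have mulB x y : cmul P (x - y) = cmul P x - cmul P y.
  by rewrite -scaleN1r cmulDr cmulZr scaleN1r.
pose u n := iter n (fun x => E + cmul P x) 0.
have uS n : u n.+1 = E + cmul P (u n) by [].
(* The difference is [P] applied [n] times to [u k], and the geometric series bounds every [u k] by
   [nr E / (1 - q)]. *)
have u_bound k n : nr (u (n + k)%N - u n) <= q ^+ n * (nr E / (1 - q)).
  have cmul0 : cmul P 0 = 0 by rewrite -(scale0r (0 : B)) cmulZr !scale0r.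
  have uk : nr (u k) <= nr E / (1 - q).
    elim: k => [|k IH]; first rewrite /nr normr0.
      by apply: divr_ge0; rewrite ?nr_ge0 ?subr_ge0 ?ltW.
    rewrite uS; apply: le_trans (nrD _ _) _.
    have -> : nr E / (1 - q) = nr E + q * (nr E / (1 - q)).
      by field; rewrite subr_eq0 gt_eqF.
    rewrite lerD2l; apply: le_trans (nrM _) _.
    by apply: ler_wpM2l => //; exact: nr_ge0.
  elim: n => [|n IH]; first by rewrite add0n subr0 expr0 mul1r.
  rewrite addSn !uS opprD addrACA subrr add0r -mulB.
  apply: le_trans (nrM _) _; rewrite exprS -mulrA.
  by apply: ler_wpM2l => //; exact: nr_ge0.
have small (e : R) : 0 < e -> exists N, forall n, (N <= n)%N ->
    q ^+ n * (nr E / (1 - q)) < e.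
  move=> e0.
  have : (fun n => (nr E / (1 - q)) * q ^+ n) @ \oo --> (0 : R).
    by apply: cvg_geometric; rewrite ger0_norm // nr_ge0.
  move=> /cvgrPdist_lt /(_ e e0) [N _ NP]; exists N => n /NP /=.
  by rewrite sub0r normrN mulrC; apply: le_lt_trans; exact: ler_norm.
have : cauchy (u @ \oo).
  apply/cauchy_ballP => e e0.
  have eR : e = (complex.Re e)%:C%C by rewrite RRe_real // gtr0_real.
  have : 0 < complex.Re e by rewrite -ltcR -eR.
  move=> /small[N NP].
  pose T := [set u n | n in [set n | (N <= n)%N]].
  exists (T, T); first by split; exists N => // n; exists n.
  move=> [_ _] [/= [n Nn <-] [m Nm <-]]; rewrite -ball_normE /= eR nrE ltcR.
  have [nm|/ltnW mn] := leqP n m.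
    apply: le_lt_trans (NP _ Nn); rewrite -(subnKC nm) /nr distrC; exact: u_bound.
  apply: le_lt_trans (NP _ Nm); rewrite -(subnKC mn) /nr; exact: u_bound.
move=> /cauchy_cvgP ucvg; pose l := lim (u @ \oo); exists l.
apply/eqP; rewrite -subr_eq0 -normr_eq0 nrE -(rmorph0 (real_complex R)).
apply/eqP; congr (_%:C)%C; apply/eqP; rewrite eq_le nr_ge0 andbT.
apply/ler_addgt0Pr => e e0; rewrite add0r.
have e2 : 0 < (e / 2)%:C%C :> R[i] by rewrite ltcR divr_gt0.
have /cvgrPdist_lt /(_ _ e2) [N _ NP] := ucvg.
have h n : (N <= n)%N -> nr (l - u n) < e / 2.
  by move=> /NP /=; rewrite nrE ltcR.
(* The defect of [l] is compared with two consecutive iterates, each of the two terms contributing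
   at most [e / 2]. *)
have -> : l - (E + cmul P l) = (l - u N.+1) - cmul P (l - u N).
  by rewrite uS mulB opprB !opprD !addrA subrK.
apply: le_trans (nrD _ _) _; rewrite (splitr e).
apply: lerD; first by apply/ltW/h.
rewrite nrN; apply: le_trans (nrM _) _.
rewrite -[e / 2]mul1r; apply: ler_pM; [exact: nr_ge0.. | exact: ltW | exact/ltW/h].
Qed.
End Contraction.

(** * Compactly supported continuous functions on the HLS groupoid *)

Section CcHLS.
Variables (G : groupType) (K : nat -> normal_subgroup G) (R : realType).
Implicit Types f : hls K -> R[i].

Lemma iso_interior_HLS : iso_interior (HLS K) = setT.
Proof.
rewrite /iso_interior (_ : iso (HLS K) = setT) ?interiorT //.
by apply/seteqP; split.
Qed.

Lemma iso_interior_at_infty (x : HLS K) :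
  iso_interior_at (hls_unit_infty K) x <-> tag (x : hls K) = None.
Proof.
rewrite /iso_interior_at iso_interior_HLS; split=> [[_ [_]]|].
  by move/(congr1 (fun y : hls K => tag y)).
by case: x => m q /= mN; subst m.
Qed.

Lemma CcP f : Cc (iso_interior (HLS K)) f <->
  continuous (f : hls K -> R[i]^o) /\
  exists C : set (hls K), compact C /\ forall x, f x != 0 -> C x.
Proof.
rewrite iso_interior_HLS; split=> [[_ [cf [C [Cc _ fC]]]]|[cf [C [Cc fC]]]].
  split; last by exists C.
  by move=> x; have := cf x; rewrite /continuous_at nbhs_subspaceT.
split; first by move=> x [].
split; last by exists C.
exact: continuous_subspaceT.
Qed.

Lemma CcD f (g : hls K -> R[i]) :
  Cc (iso_interior (HLS K)) f -> Cc (iso_interior (HLS K)) g ->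
  Cc (iso_interior (HLS K)) (fun x => f x + g x).
Proof.
move=> /CcP[cf [C [cC fC]]] /CcP[cg [D [cD gD]]]; apply/CcP; split.
  by move=> x; exact: (@cvgD _ R[i]^o _ _ _ f g _ _ (cf x) (cg x)).
exists (C `|` D); split; first exact: compactU.
move=> x; have [->|/fC ? _] := eqVneq (f x) 0; last by left.
by rewrite add0r => /gD; right.
Qed.

Lemma CcZ c f : Cc (iso_interior (HLS K)) f ->
  Cc (iso_interior (HLS K)) (fun x => c * f x).
Proof.
move=> /CcP[cf [C [cC fC]]]; apply/CcP; split.
  by move=> x; exact: (@cvgZl_tmp _ R[i]^o _ _ _ c f _ (cf x)).
exists C; split=> // x; have [->|/fC //] := eqVneq (f x) 0.
by rewrite mulr0 eqxx.
Qed.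

Lemma Cc_sum (I : finType) (F : I -> hls K -> R[i]) :
  (forall i, Cc (iso_interior (HLS K)) (F i)) ->
  Cc (iso_interior (HLS K)) (fun x => \sum_i F i x).
Proof.
move=> CF; elim: (index_enum I) => [|i r IH].
  rewrite (_ : (fun x => _) = fun=> 0); last by apply/funext => x; rewrite big_nil.
  apply/CcP; split; first exact: cst_continuous.
  by exists set0; split=> [|x]; [exact: compact0 | rewrite eqxx].
rewrite (_ : (fun x => _) = fun x => F i x + \sum_(j <- r) F j x); first exact: CcD.
by apply/funext => x; rewrite big_cons.
Qed.

Lemma Cc_lmul s f : Cc (iso_interior (HLS K)) f ->
  Cc (iso_interior (HLS K)) (fun x => f (hls_lmul s x)).
Proof.
move=> /CcP[cf [C [cC fC]]]; apply/CcP; split.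
  by move=> x; apply: continuous_comp; [exact: hls_lmul_continuous | exact: cf].
exists (hls_lmul s^-1%g @` C); split.
  apply: continuous_compact => //; apply: continuous_subspaceT.
  exact: hls_lmul_continuous.
by move=> x /fC Cx; exists (hls_lmul s x) => //; rewrite hls_lmulK.
Qed.

Hypothesis K_sep : forall g, g != 1%g ->
  exists N, forall n, (N <= n)%N -> ~ nsset (K n) g.

(* Separation is what makes hls_sec g closed, hence its indicator continuous. *)
Lemma Cc_sec g : Cc (iso_interior (HLS K))
  (fun x => (x == hls_sec K g (tag x))%:R : R[i]).
Proof.
apply/CcP; split; last first.
  exists (range (hls_sec K g)); split; first exact: compact_hls_sec.
  move=> x; case: (x =P hls_sec K g (tag x)) => [xE _|_]; last by rewrite eqxx.
  by exists (tag x).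
apply/(@hls_continuousP G K R[i]^o) => h U /nbhs_singleton /= U0.
have [hg|hg] := eqVneq h g.
  by subst h; exists 0%N => m _; move: U0; rewrite !eqxx.
have hg1 : (h^-1 * g)%g != 1%g.
  by rewrite -(inj_eq (mulgI h)) mulKVg mulg1 eq_sym.
have [N NP] := K_sep hg1.
have neq m : idx_gt N m -> (hls_sec K h m == hls_sec K g (tag (hls_sec K h m))) = false.
  move=> mN; apply/eqP => /(@hlsE_inj _ _ _) /=; case: m mN => [k|_] /=.
    by move=> /ltnW kN /quotg_piP; exact: NP.
  by move/eqP; rewrite (negPf hg).
by exists N => m mN; move: U0; rewrite !neq.
Qed.

Lemma frestrict_infty f : frestrict (iso_interior_at (hls_unit_infty K)) f =
  (fun x : hls K => if tag x == None then f x else 0).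
Proof.
apply/funext => x; rewrite /frestrict; case: eqP => h.
  by rewrite mem_set //; exact/iso_interior_at_infty.
by rewrite memNset // => /iso_interior_at_infty.
Qed.

Lemma Cc_frestrict f (D : set G) : finite_set D ->
  (forall g, f (hls_sec K g None) != 0 -> D g) ->
  Cc (iso_interior (HLS K)) f ->
  Cc (iso_interior_at (hls_unit_infty K))
    (frestrict (iso_interior_at (hls_unit_infty K)) f).
Proof.
move=> finD fD /CcP[cf _]; split; first by move=> x Sx; rewrite /frestrict memNset.
split.
  apply: (subspace_eq_continuous (f := f : HLS K -> R[i]^o)).
    by move=> x Sx; rewrite /from_subspace /frestrict Sx.
  exact: continuous_subspaceT.
exists [set hls_sec K g None | g in D]; split.
- by apply: finite_compact; exact: finite_image.
- by move=> _ [g _ <-]; exact/iso_interior_at_infty.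
move=> x; rewrite frestrict_infty; case: (tag (x : hls K) =P None); last by rewrite eqxx.
by case: x => m g /= mN; subst m => /fD Dg; exists g.
Qed.

(** For large [n] the support of [f] in the fibre lies on the sections of a fixed finite list [s],
    and along each of them [f] tends to its value 0 at infinity. *)
Lemma Cc_fiber_sum_small f (e : R) : (forall n, finite_set [set: quotg (K n)]) ->
  Cc (iso_interior (HLS K)) f -> (forall g, f (hls_sec K g None) = 0) -> 0 < e ->
  exists n, Normc.normc (fiber_sum n f) < e.
Proof.
move=> finK /CcP[cf [C [cC fC]]] f0 e0.
have [s [N0 sP]] := compact_hls_bound cC.
(* The successor keeps the denominator nonzero and makes the final bound strict. *)
pose d : R := e / (size s).+1%:R.
have d0 : 0 < d by rewrite divr_gt0.
have h g : exists N, forall m, idx_gt N m -> Normc.normc (f (hls_sec K g m)) < d.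
  have /hls_continuousP/(_ g (ball (0 : R[i]^o) d%:C%C)) := cf.
  case; first by rewrite f0; apply: nbhsx_ballx; rewrite ltcR.
  move=> N NP; exists N => m /NP; rewrite -ball_normE /= sub0r normrN complex_norm.
  by rewrite ltcR.
pose Ng g := projT1 (cid (h g)).
pose n := (N0 + \max_(g <- s) Ng g).+1.
have fs g : g \in s -> Normc.normc (f (hls_sec K g (Some n))) < d.
  move=> gs; apply: (projT2 (cid (h g))) => /=; rewrite ltnS.
  by apply: leq_trans (leq_addl _ _); exact: (leq_bigmax_seq (F := Ng)).
(* Elements of [s] may share a class in the quotient; each class must be summed once. *)
pose r := undup [seq hls_pi K (Some n) g | g <- s].
exists n; rewrite /fiber_sum (fsbigE r) ?undup_uniq //; last first.
  move=> a _ ar; apply: contraNeq (ar) => /fC /sP[|g gs /(@hlsE_inj _ _ _) ->].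
    by rewrite ltnS leq_addr.
  by rewrite mem_undup map_f.
under eq_bigl do rewrite in_setT.
have rd : {in r, forall a : hls_fiber K (Some n), Normc.normc (f (hlsE a)) < d}.
  by move=> a; rewrite mem_undup => /mapP[g gs ->]; exact: fs.
have {rd} le_r (r' : seq (hls_fiber K (Some n))) :
    {subset r' <= r} -> Normc.normc (\sum_(a <- r') f (hlsE a)) <= (size r')%:R * d.
  elim: r' => [|a r' IH] sub; first by rewrite big_nil Normc.normc0 mul0r.
  rewrite big_cons; apply: le_trans (le_normcD _ _) _.
  rewrite /= -natr1 mulrDl mul1r addrC; apply: lerD; last first.
    by apply/ltW/rd/sub; rewrite mem_head.
  by apply: IH => b br; apply: sub; rewrite in_cons br orbT.
apply: le_lt_trans (le_r r (fun _ => id)) _.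
rewrite /d mulrCA -[ltRHS]mulr1 ltr_pM2l // ltr_pdivrMr // mul1r ltr_nat ltnS.
by rewrite (leq_trans (size_undup _)) ?size_map.
Qed.
End CcHLS.

(** * The mean of the letters as an element of the convolution algebra *)

Section Averaging.
Variable R : realType.
Implicit Types f xi : hls F2_K -> R[i].

Let sec g : hls F2_K -> R[i] := fun x => (x == hls_sec F2_K g (tag x))%:R.

(** Letters that become equal in a quotient are counted with multiplicity, so the total mass is 1 on
    every finite fibre. *)
Definition letter_mean : hls F2_K -> R[i] :=
  fun x => \sum_(s : letter) 4^-1 * (x == hls_sec F2_K (letter_elt s) (tag x))%:R.

Lemma letter_mean_fiber n (a : hls_fiber F2_K n) :
  letter_mean (hlsE a) =
  \sum_(s : letter) (if a == hls_pi F2_K n (letter_elt s) then 4^-1 else 0).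
Proof.
apply: eq_bigr => s _ /=; have [->|na] := eqVneq a; first by rewrite eqxx mulr1.
case: eqP => [/(@hlsE_inj _ _ _) e|_]; last by rewrite mulr0.
by rewrite e eqxx in na.
Qed.

Lemma Cc_letter_mean : Cc (iso_interior F2_HLS) letter_mean.
Proof.
apply: (@Cc_sum _ F2_K _ letter (fun s x => 4^-1 * sec (letter_elt s) x)) => s.
by apply: CcZ; apply: Cc_sec; exact: F2_K_separates.
Qed.

Lemma Cc_letter_avg f : Cc (iso_interior F2_HLS) f ->
  Cc (iso_interior F2_HLS) (letter_avg f).
Proof.
move=> Cf; apply: (@Cc_sum _ F2_K _ letter
  (fun s x => 4^-1 * f (hls_lmul (letter_elt s)^-1%g x))) => s.
by apply: CcZ; exact: Cc_lmul.
Qed.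

Lemma conv_letter_mean f : @Defs.conv R F2_HLS letter_mean f = letter_avg f.
Proof.
apply/funext => -[n q]; apply: conv_point_masses => a; exact: letter_mean_fiber.
Qed.

(** The vectors tested are supported on the fibre at infinity, where convolution by the restricted
    mean is [letter_avg]; elsewhere both sides vanish because translations preserve fibres. *)
Lemma rnorm_letter_mean_infty :
  (rnorm (iso_interior_at F2_u) (frestrict (iso_interior_at F2_u) letter_mean)
   <= (7 / 8)%:E)%E.
Proof.
apply: ge_ereal_sup => _ [v _ <-]; apply: ge_ereal_sup => _ [xi [xiS xi1] <-].
have xi0 (y : hls F2_K) : tag y != None -> xi y = 0.
  move=> /eqP yN; apply: xiS => -[/(@iso_interior_at_infty _ F2_K) h _]; exact: yN.
suff -> : Defs.conv (frestrict (iso_interior_at F2_u) letter_mean) xi = letter_avg xi.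
  exact: letter_avg_bound.
rewrite frestrict_infty; apply/funext => -[n q].
have [nN|nN] := eqVneq n None.
  by subst n; apply: conv_point_masses => a /=; exact: letter_mean_fiber.
rewrite (@conv_hlsE _ F2_K R _ _ n q) /letter_avg fsbig1 => [|a _]; last first.
  by rewrite xi0 ?mulr0.
by rewrite big1 // => s _; rewrite xi0 ?mulr0.
Qed.

(** The fibre sum is invariant under translation, and four weights 1/4 add up to 1. *)
Lemma fiber_sum_letter_avg n f : fiber_sum n (letter_avg f) = fiber_sum n f.
Proof.
have fin := F2_quotient_finite n.
transitivity (\sum_(s : letter) 4^-1 * fiber_sum n f).
  rewrite /letter_avg; transitivity (\sum_(s : letter)
      fiber_sum n (fun x => 4^-1 * f (hls_lmul (letter_elt s)^-1%g x))).
    elim: (index_enum _) => [|s r IH].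
      by rewrite big_nil /fiber_sum fsbig1 // => a _; rewrite big_nil.
    rewrite big_cons -IH -fiber_sumD //; congr fiber_sum.
    by apply/funext => x; rewrite big_cons.
  by apply: eq_bigr => s _; rewrite fiber_sumZ // fiber_sum_lmul.
rewrite sumr_const card_prod card_bool -mulrnAl -[4^-1 *+ _]mulr_natl.
by rewrite divff ?mul1r ?pnatr_eq0.
Qed.
End Averaging.

(** * Approximation in the reduced algebra and the contradiction *)

Lemma closure_dist (R : realType) (A : cstar_algebra R) (D : set A) (a : A) (e : R[i]) :
  closure D a -> 0 < e -> exists2 d, D d & `|a - d| < e.
Proof.
move=> Da e0; have [d [Dd]] := Da _ (nbhsx_ballx a e e0).
by rewrite -ball_normE; exists d.
Qed.

Theorem theorem4p8 (R : realType)
  (A : cstar_algebra R) (iotaA : (F2_HLS -> R[i]) -> A)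
  (B : cstar_algebra R) (iotaB : (F2_HLS -> R[i]) -> B)
  (A_reduced : reduced_cstar (iso_interior F2_HLS) iotaA)
  (B_reduced : reduced_cstar (iso_interior_at F2_u) iotaB)
  (theta : quot_alg (Jr F2_u iotaA) -> B)
  (theta_hom : quot_star_hom theta)
  (theta_surj : forall b : B, exists a, theta a = b)
  (theta_restr : forall f : F2_HLS -> R[i], Cc (iso_interior F2_HLS) f ->
     theta (quot_cls (Jr F2_u iotaA) (iotaA f))
       = iotaB (frestrict (iso_interior_at F2_u) f)) :
  ~ injective theta.
Proof.
move=> theta_inj.
have [iotaD iotaZ iotaM _ [iotaN iota_dense]] := A_reduced.
set V := iso_interior F2_HLS in iotaD iotaZ iotaM iotaN iota_dense theta_restr.
pose e1 : F2_HLS -> R[i] := fun x => (x == hls_sec F2_K 1%g (tag (x : hls F2_K)))%:R.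
have Ce1 : Cc V e1 by apply: Cc_sec; exact: F2_K_separates.
have Cp : Cc V (@letter_mean R) := @Cc_letter_mean R.
pose E := theta (quot_cls (Jr F2_u iotaA) (iotaA e1)).
pose P := theta (quot_cls (Jr F2_u iotaA) (iotaA (@letter_mean R))).
have P1 : `|P| < 1.
  have [_ _ _ _ [iotaBN _]] := B_reduced.
  rewrite -(RRe_real (normr_real P)) -[1](rmorph1 (real_complex R)) ltcR.
  (* [P] is the image of the restricted mean, whose support is the finite set of letters, so its
     norm is the reduced norm bounded by 7/8. *)
  rewrite /P theta_restr // -lte_fin -iotaBN; last first.
    apply: (@Cc_frestrict _ F2_K _ _ (letter_elt @` setT)) => //.
      by apply: finite_image; exact: finite_finset.
    move=> g; rewrite letter_mean_fiber; apply: contra_neqP => ng.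
    by rewrite big1 // => s _; case: eqP => // e; case: ng; exists s.
  apply: le_lt_trans (rnorm_letter_mean_infty R) _; rewrite lte_fin; lra.
have [b bE] := cmul_affine_fixpoint E P1.
(* A point of the quotient is a coset bundled with an existence proof; proof irrelevance identifies
   it with the class of a representative [a]. *)
have [[T [a Ta]] thetaT] := theta_surj b.
have {T Ta thetaT} theta_a : theta (quot_cls (Jr F2_u iotaA) a) = b.
  rewrite -thetaT; congr theta; rewrite /quot_cls; subst T.
  by congr exist; exact: Prop_irrelevance.
have [hD hZ hM _] := theta_hom.
have hB x y : theta (quot_cls (Jr F2_u iotaA) (x - y)) =
    theta (quot_cls (Jr F2_u iotaA) x) - theta (quot_cls (Jr F2_u iotaA) y).
  by rewrite -scaleN1r hD hZ scaleN1r.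
pose p := iotaA (@letter_mean R).
pose w := a - cmul p a - iotaA e1.
have Cf0 : Cc V (fun=> 0 : R[i]).
  by have := CcZ 0 Ce1; congr Cc; apply/funext => x; rewrite mul0r.
have iota0 : iotaA (fun=> 0) = 0.
  have := iotaZ 0 e1 Ce1; rewrite scale0r => <-; congr iotaA.
  by apply/funext => x; rewrite mul0r.
have Jw : Jr F2_u iotaA w.
  have : quot_cls (Jr F2_u iotaA) w = quot_cls (Jr F2_u iotaA) 0.
    apply: theta_inj; rewrite /w !hB hM theta_a -/P -/E.
    have -> : theta (quot_cls (Jr F2_u iotaA) 0) = 0.
      by have := hB 0 0; rewrite !subrr.
    by rewrite {1}bE addrK subrr.
  (* Evaluating the two equal cosets at [w] identifies membership of [w] in the ideal with
     membership of 0. *)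
  move=> /(congr1 sval) /= /(congr1 (fun Z : set A => Z w)).
  move=> /=; rewrite subr0 subrr => <-; apply: subset_closure.
  by exists (fun=> 0).
have K0 : 0 < 2 + `|p| by rewrite ltr_pwDl.
(* Chosen so that two errors [eps] and one error [eps] multiplied by the norm of [p] add up to
   exactly 1/2. *)
pose eps : R[i] := (2 * (2 + `|p|))^-1.
have eps0 : 0 < eps by rewrite invr_gt0 mulr_gt0.
have [_ [f Cf <-] af] : exists2 d, (iotaA @` Cc V) d & `|a - d| < eps.
  by apply: closure_dist eps0; rewrite iota_dense.
have [_ [h [Ch h0] <-] wh] := closure_dist Jw eps0.
(* With [f] close to [a] and [h] close to [w], this function-level version of
   [a - cmul p a - iotaA e1 - w], which is 0, has small norm. *)
pose F x := f x + -1 * (letter_avg f x + (e1 x + h x)).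
have CF1 : Cc V (fun x => e1 x + h x) by exact: CcD.
have CF2 : Cc V (fun x => letter_avg f x + (e1 x + h x)).
  by apply: CcD => //; exact: Cc_letter_avg.
have CF3 : Cc V (fun x => -1 * (letter_avg f x + (e1 x + h x))) by exact: CcZ.
have CF : Cc V F by exact: CcD.
have iotaF : iotaA F = (w - iotaA h) - (a - iotaA f) + cmul p (a - iotaA f).
  rewrite iotaD // iotaZ // iotaD ?iotaD //; last exact: Cc_letter_avg.
  rewrite -(conv_letter_mean f) iotaM // -/p.
  have -> : cmul p (a - iotaA f) = cmul p a - cmul p (iotaA f).
    by rewrite -scaleN1r cmulDr cmulZr scaleN1r.
  rewrite scaleN1r /w; set pa := cmul p a; set pf := cmul p (iotaA f).
  rewrite -addrA opprB.
  have -> : iotaA f - a + (pa - pf) = iotaA f - pf - (a - pa).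
    by rewrite opprB addrACA [RHS]addrACA [- a + _]addrC.
  move: (a - pa) => u.
  by rewrite [RHS]addrC -(addrA u) [RHS]addrA subrK !opprD !addrA.
have normF : `|iotaA F| < 2^-1.
  have -> : 2^-1 = (eps + eps) + `|p| * eps.
    by rewrite /eps; field; rewrite gt_eqF.
  rewrite iotaF; apply: le_lt_trans (ler_normD _ _) _; apply: ltr_leD.
    by apply: le_lt_trans (ler_normB _ _) _; exact: ltrD.
  by apply: le_trans (cnormM _ _) _; apply: ler_wpM2l => //; exact: ltW.
have h0' g : h (hls_sec F2_K g None) = 0.
  by apply: h0; exact/iso_interior_at_infty.
have half0 : 0 < 2^-1 :> R by rewrite invr_gt0.
have [n hn] := Cc_fiber_sum_small F2_quotient_finite Ch h0' half0.
have fin := F2_quotient_finite n.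
(* Averaging preserves the fibre sum, so [f] drops out: only the unit section, with sum 1, and the
   small contribution of [h] remain. *)
have sumF : fiber_sum n F = -1 * (1 + fiber_sum n h).
  rewrite /F fiber_sumD // fiber_sumZ // fiber_sumD // fiber_sum_letter_avg.
  by rewrite fiber_sumD // fiber_sum_unit //; ring.
have := normc_fiber_sum_le fin F (iso_interior_HLS F2_K).
rewrite iotaN // lee_fin sumF Normc.normcM normcN Normc.normc1 mul1r => le1.
have : complex.Re `|iotaA F| < 2^-1.
  rewrite -ltcR RRe_real ?normr_real // fmorphV rmorph_nat; exact: normF.
apply/negP; rewrite -leNgt; apply: le_trans le1.
(* The character at [F] has modulus at least 1 minus that at [h], hence more than 1/2, against the
   norm bound on [iotaA F]. *)
have := le_normcD (1 + fiber_sum n h) (- fiber_sum n h).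
rewrite addrK Normc.normc1 normcN; lra.
Qed.
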